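(* Let $n\ge 1$ and let $X_1,\dots,X_n$ be non-empty sets. Let $S$ be a finite non-empty subset of $X_1\times X_2\times\cdots\times X_n$ of cardinality $k$, and for $1\le i\le n$ let $m_i$ denote the cardinality of $\Pi_iS$, the canonical projection of $S$ on $X_i$. Then $S$ is good if and only if $k\le m_1+m_2+\cdots+m_n-(n-1)$ and the matrix $M$ of $S$ has rank $k$. Moreover, for any finite non-empty sets $Y_1,\dots,Y_n$ of cardinalities $m_1,\dots,m_n$ and any positive integer $k\le m_1+m_2+\cdots+m_n-(n-1)$, there exists a good subset of $Y_1\times\cdots\times Y_n$ of cardinality $k$.
   Context: A set $S\subset X_1\times\cdots\times X_n$ is good if every function $f:S\to\mathbb{R}$ can be written as $f(x_1,\dots,x_n)=u_1(x_1)+\cdots+u_n(x_n)$ for all $(x_1,\dots,x_n)\in S$, for some functions $u_i:X_i\to\mathbb{R}$. $\Pi_i:X_1\times\cdots\times X_n\to X_i$ is the canonical projection on the $i$-th coordinate. The matrix of $S$: enumerate $\Pi_iS=\{x^{(i)}_1,\dots,x^{(i)}_{m_i}\}$ for $1\le i\le n$ and $S=\{s_1,\dots,s_k\}$, where $s_j=(x^{(1)}_{j_1},x^{(2)}_{j_2},\dots,x^{(n)}_{j_n})$ with $1\le j_i\le m_i$. The matrix $M$ of $S$ is the $k\times(m_1+\cdots+m_n)$ real matrix whose $j$-th row has entry $1$ at the places $j_1,\ m_1+j_2,\ m_1+m_2+j_3,\ \dots,\ m_1+\cdots+m_{n-1}+j_n$ and entry $0$ elsewhere. *)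

(* Defs.v *)
From mathcomp Require Import all_boot all_order all_algebra.
From mathcomp Require Import all_classical all_reals.

Set Implicit Arguments.
Unset Strict Implicit.
Unset Printing Implicit Defensive.

Import Order.TTheory GRing.Theory Num.Theory.

Local Open Scope classical_set_scope.
Local Open Scope ring_scope.

(* The product X_1 x ... x X_n is the type of dependent functions on 'I_n. *)
Definition good (R : realType) (n : nat) (X : 'I_n -> Type)
    (S : set (forall i, X i)) : Prop :=
  forall f : S -> R, exists u : forall i, X i -> R,
    forall s : S, f s = \sum_(i < n) u i (val s i).

(* [J j i] is the index j_i: the i-th coordinate of the j-th point is
   the (j_i)-th element of the i-th projection.  The i-th column block, of
   width [m i], comes after the blocks of widths m_1, ..., m_(i-1). *)
Definition incidence_mx (R : realType) (n k : nat) (m : 'I_n -> nat)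
    (J : 'I_k -> forall i, 'I_(m i)) : 'M[R]_(k, \sum_(i < n) m i) :=
  mxrow (fun i : 'I_n => \matrix_(j < k, l < m i) (l == J j i)%:R).

(* The matrix of S depends on the enumerations [x i] of the projections of S
   and on that of S, so it is characterised by a relation. *)
Definition is_matrix_of (R : realType) (n k : nat) (m : 'I_n -> nat)
    (X : 'I_n -> Type) (S : set (forall i, X i))
    (M : 'M[R]_(k, \sum_(i < n) m i)) : Prop :=
  exists (x : forall i, 'I_(m i) -> X i) (J : 'I_k -> forall i, 'I_(m i)),
    [/\ forall i, set_bij setT (proj i @` S) (x i),
        set_bij setT S (fun j i => x i (J j i)) &
        M = incidence_mx R J].

(* Main.v *)
(** Evaluating a sum of coordinate functions at the points of S is
    multiplication by the matrix M of S, so S is good exactly when M has a right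
    inverse, that is, rank k.  M maps the indicator of each of the n column
    blocks to the all-ones vector, so the n - 1 differences of block indicators
    lie in its kernel and k = rank M <= m_1 + ... + m_n - (n - 1).  Conversely,
    there are m_1 + ... + m_n - (n - 1) points that differ from a base point o
    in at most one coordinate, and any set of them is good: a function f on it,
    extended by 0, is the sum of the functions
    u_i(y) = f(o with y at i) - f(o), up to adding f(o) to one of them. *)
Require Import Defs.
From mathcomp Require Import all_boot all_order all_algebra.
From mathcomp Require Import all_classical all_reals.

Set Implicit Arguments.
Unset Strict Implicit.
Unset Printing Implicit Defensive.

Import GRing.Theory.

Local Open Scope classical_set_scope.
Local Open Scope card_scope.
Local Open Scope ring_scope.

(** Trades functions on the subtype of S for vectors indexed by ['I_k], so that goodness becomes
    solvability of a linear system. *)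
Lemma good_range (R : realType) (n k : nat) (X : 'I_n -> Type)
    (p : 'I_k -> forall i, X i) (p_inj : injective p) :
  good R (range p) <->
  forall b : 'I_k -> R, exists u : forall i, X i -> R,
    forall j, b j = \sum_(i < n) u i (p j i).
Proof.
split=> [gp b|gp f].
(* The value at [s] is that of [b] at the unique index of [s]; the default 0 is never taken, as [s]
   lies in the range of [p]. *)
- have [] := gp (fun s => if [pick j | `[< p j = val s >]] is Some j
                          then b j else 0).
  move=> u fE; exists u => j.
  have pj : p j \in range p by apply/mem_set; exists j.
  have := fE (exist _ (p j) pj); rewrite /= => <-.
  case: pickP => [j' /asboolP/p_inj -> //|/(_ j)/asboolP]; by case.
- have mem_p j : p j \in range p by apply/mem_set; exists j.
  have [u fE] := gp (fun j => f (exist _ (p j) (mem_p j))).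
  exists u => s; have /set_mem[j _ pj] := valP s.
  rewrite -pj -fE; congr f; exact/val_inj.
Qed.

(** Row [j] of the matrix has exactly one entry 1 in each block [i], at column
    [tagnat.Rank i (J j i)]. *)
Lemma incidence_mulE (R : realType) (n k c : nat) (m : 'I_n -> nat)
    (J : 'I_k -> forall i, 'I_(m i)) (N : 'M[R]_(\sum_(i < n) m i, c)) j a :
  (incidence_mx R J *m N) j a = \sum_(i < n) N (tagnat.Rank i (J j i)) a.
Proof.
rewrite -[N in LHS]submxcolK mul_mxrow_mxcol summxE; apply: eq_bigr => i _.
rewrite mxE (bigD1 (J j i)) //= big1 ?addr0 => [|l /negPf lJ].
  by rewrite !mxE eqxx mul1r.
by rewrite !mxE lJ mul0r.
Qed.

Lemma good_row_free (R : realType) (n k : nat) (m : 'I_n -> nat)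
    (X : 'I_n -> Type) (x : forall i, 'I_(m i) -> X i)
    (x_inj : forall i, injective (x i)) (J : 'I_k -> forall i, 'I_(m i))
    (p_inj : injective (fun j i => x i (J j i))) :
  good R (range (fun j i => x i (J j i))) <-> row_free (incidence_mx R J).
Proof.
rewrite good_range //; split=> [gp|/row_freeP[N MN] b].
- apply: inj_row_free => w wM; apply/rowP=> j.
  (* Decomposing the indicator of [j] yields a column [v] with [M v = e_j], so [w M = 0] forces
     [w_j = 0]. *)
  have [u uE] := gp (fun j' => (j' == j)%:R).
  pose v : 'cV[R]_(\sum_(i < n) m i) :=
    \col_a u (tagnat.sig1 a) (x _ (tagnat.sig2 a)).
  have Mv : incidence_mx R J *m v = delta_mx j 0.
    apply/colP=> j'; rewrite incidence_mulE !mxE andbT uE.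
    by apply: eq_bigr => i _; rewrite mxE /tagnat.sig2 /tagnat.sig1
      /tagnat.Rank tagnat.rankK.
  have := congr1 (fun A => (A *m v) 0 0) wM.
  rewrite -mulmxA Mv mul0mx -colE !mxE; exact.
- pose v := N *m \col_j b j.
  (* By injectivity of [x i] the sum has at most one term; it is 0 off the image of [x i]. *)
  exists (fun i y => \sum_(l | `[< x i l = y >]) v (tagnat.Rank i l) 0) => j.
  have <- : (incidence_mx R J *m v) j 0 = b j by rewrite mulmxA MN mul1mx mxE.
  rewrite incidence_mulE; apply: eq_bigr => i _.
  rewrite (big_pred1 (J j i)) // => l.
  by apply/asboolP/eqP => [/x_inj|->].
Qed.

Lemma rank_incidence_mx (R : realType) (n k : nat) (m : 'I_n -> nat)
    (J : 'I_k -> forall i, 'I_(m i)) (k_gt0 : (0 < k)%N) :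
  (\rank (incidence_mx R J) <= \sum_(i < n) m i - (n - 1))%N.
Proof.
case: n => [|n] in m J *; first by rewrite subn0 rank_leq_col.
rewrite subn1 /=.
(* Column [c] of [D] is the indicator of block [c + 1] minus that of block 0. *)
pose D : 'M[R]_(\sum_(i < n.+1) m i, n) := \matrix_(a, c)
  ((tagnat.sig1 a == lift ord0 c)%:R - (tagnat.sig1 a == ord0)%:R).
(* A left inverse of [D]: row [c] selects one index in block [c + 1], supplied by the point of index
   0. *)
pose E : 'M[R]_(n, \sum_(i < n.+1) m i) := \matrix_(c, a)
  (a == tagnat.Rank (lift ord0 c) (J (Ordinal k_gt0) (lift ord0 c)))%:R.
have ED : E *m D = 1%:M.
  apply/matrixP=> c c'; rewrite mxE.
  pose a0 := tagnat.Rank (lift ord0 c) (J (Ordinal k_gt0) (lift ord0 c)).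
  rewrite (bigD1 a0) //=.
  rewrite [X in _ + X]big1 => [|a /negPf aJ]; last by rewrite mxE aJ mul0r.
  by rewrite !mxE eqxx tagnat.Rank1K (inj_eq lift_inj) mul1r subr0 addr0.
have MD : incidence_mx R J *m D = 0.
  apply/matrixP=> j c; rewrite incidence_mulE mxE.
  under eq_bigr do rewrite mxE tagnat.Rank1K.
  have sum_eq (i0 : 'I_n.+1) : \sum_i (i == i0)%:R = 1 :> R.
    by rewrite (bigD1 i0) //= eqxx big1 ?addr0 // => i /negPf ->.
  by rewrite sumrB !sum_eq subrr.
have rD : (n <= \rank D)%N by have := mxrankM_maxr E D; rewrite ED mxrank1.
have rMD := mulmx0_rank_max MD.
(* The subtraction is not truncated: [D] has rank at least [n], hence at least [n] rows. *)
rewrite leq_subRL ?(leq_trans rD) ?rank_leq_row //.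
by rewrite addnC (leq_trans _ rMD) // leq_add2l.
Qed.

Lemma good_dfwith (R : realType) (n k : nat) (n_gt0 : (0 < n)%N)
    (Y : 'I_n -> Type) (o : forall i, Y i) (p : 'I_k -> forall i, Y i)
    (p_inj : injective p)
    (p_axis : forall j, exists i (y : Y i), p j = dfwith o _ y) :
  good R (range p).
Proof.
rewrite good_range // => b.
pose f s := if [pick j | `[< p j = s >]] is Some j then b j else 0.
have fp j : f (p j) = b j.
  rewrite /f; case: pickP => [j' /asboolP/p_inj -> //|/(_ j)/asboolP]; by case.
pose i0 := Ordinal n_gt0.
exists (fun i y => f (dfwith o _ y) - f o + (if i == i0 then f o else 0)) => j.
have dfwith_o i : dfwith o _ (o i) = o.
  by apply/functional_extensionality_dep => i'; case: dfwithP.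
rewrite big_split /= -big_mkcond big_pred1_eq -fp.
have [i [y ->]] := p_axis j.
(* The point differs from [o] at most in coordinate [i], so only the [i]-th difference survives. *)
rewrite (bigD1 i) //= dfwithin big1 ?addr0 ?subrK // => i' ii'.
by rewrite dfwithout 1?eq_sym // dfwith_o subrr.
Qed.

(** [None] encodes the base point, and [Some] moves one coordinate to a value of nonzero index; the
    moved coordinate and its value can thus be read off the point. *)
Lemma inj_dfwith_option (n : nat) (Y : 'I_n -> Type) (m : 'I_n -> nat)
    (e : forall i, 'I_(m i).+1 -> Y i) (e_inj : forall i, injective (e i)) :
  injective (fun t : option {i : 'I_n & 'I_(m i)} =>
    if t is Some (existT i l) then
      dfwith (fun i => e i ord0) _ (e i (lift ord0 l))
    else fun i => e i ord0).
Proof.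
move=> [[i l]|] [[i' l']|] //= E.
- have := congr1 (fun s => s i) E; rewrite dfwithin.
  case: (eqVneq i' i) => [ii'|ii'].
    by case: i / ii' in l E *; rewrite dfwithin => /e_inj/lift_inj ->.
  by rewrite dfwithout // => /e_inj /(congr1 val).
- by have := congr1 (fun s => s i) E; rewrite dfwithin => /e_inj /(congr1 val).
- have := congr1 (fun s => s i') E; rewrite dfwithin.
  by move=> /e_inj /(congr1 val).
Qed.

Lemma card_ord_inj (T : Type) (d : nat) :
  [set: T] #= `I_d -> exists e : 'I_d -> T, injective e.
Proof.
move=> /card_eq_trans/(_ card_II); rewrite card_eq_sym => /card_bijP[f f_bij].
exists (fun l => val (f (exist _ l (in_setT l)))) => l l'.
by move=> /val_inj/(bij_inj f_bij)/(congr1 val).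
Qed.

Lemma sum_predn (n : nat) (m : 'I_n -> nat) :
  (forall i, 0 < m i)%N -> (\sum_(i < n) m i = \sum_(i < n) (m i).-1 + n)%N.
Proof.
move=> m_gt0; rewrite -[X in (_ + X)%N]card_ord -sum1_card -big_split /=.
by apply: eq_bigr => i _; rewrite addn1 prednK.
Qed.

(** Here [m i] counts the values other than the base one on axis [i], so the axes carry
    [1 + \sum_i m i] points in all, of which any [k] will do. *)
Lemma exists_good (R : realType) (n : nat) (n_gt0 : (0 < n)%N)
    (m : 'I_n -> nat) (Y : 'I_n -> Type)
    (e : forall i, 'I_(m i).+1 -> Y i) (e_inj : forall i, injective (e i))
    (k : nat) (k_le : (k <= (\sum_(i < n) m i).+1)%N) :
  exists S : set (forall i, Y i), S #= `I_k /\ good R S.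
Proof.
pose o i := e i ord0.
pose g (t : option {i : 'I_n & 'I_(m i)}) : forall i, Y i :=
  if t is Some (existT i l) then dfwith o _ (e i (lift ord0 l)) else o.
have g_inj : injective g by exact: inj_dfwith_option.
have k_card : (k <= #|{: option {i : 'I_n & 'I_(m i)}}|)%N.
  by rewrite card_option tagnat.card.
pose p j := g (enum_val (widen_ord k_card j)).
have p_inj : injective p.
  by move=> j j' /g_inj/enum_val_inj/(congr1 val)/= jj'; exact: val_inj.
exists (range p); split.
  apply: (@card_eq_trans _ _ _ _ [set: 'I_k]).
    by apply: inj_card_eq => j j' _ _; apply: p_inj.
  by rewrite card_eq_sym card_II.
apply: (good_dfwith n_gt0 (o := o) p_inj) => j; rewrite /p.
case: (enum_val _) => [[i l]|]; first by exists i, (e i (lift ord0 l)).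
(* The base point lies on every axis: replace a coordinate by its own value. *)
exists (Ordinal n_gt0), (o (Ordinal n_gt0)).
by apply/functional_extensionality_dep => i /=; case: dfwithP.
Qed.

Theorem theorem1p3 (R : realType) (n : nat) (n_ge1 : (1 <= n)%N) :
  (forall (X : 'I_n -> Type) (X_nonempty : forall i, inhabited (X i))
      (S : set (forall i, X i)) (S_nonempty : S !=set0)
      (k : nat) (S_card : S #= `I_k)
      (m : 'I_n -> nat) (proj_card : forall i, proj i @` S #= `I_(m i))
      (M : 'M[R]_(k, \sum_(i < n) m i)) (MS : is_matrix_of S M),
    good R S <->
      (k <= \sum_(i < n) m i - (n - 1))%N /\ \rank M = k) /\
  (forall (m : 'I_n -> nat) (Y : 'I_n -> Type)
      (Y_nonempty : forall i, inhabited (Y i))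
      (Y_card : forall i, [set: Y i] #= `I_(m i))
      (k : nat) (k_gt0 : (0 < k)%N)
      (k_le : (k <= \sum_(i < n) m i - (n - 1))%N),
    exists S : set (forall i, Y i), S #= `I_k /\ good R S).
Proof.
split=> [X _ S [s Ss] k _ m _ M [x [J [x_bij [pS p_inj p_surj] ->]]]|].
- have x_inj i : injective (x i).
    by case: (x_bij i) => _ xi _ l l'; apply: xi; rewrite in_setT.
  have {}p_inj : injective (fun j i => x i (J j i)).
    by move=> j j'; apply: p_inj; rewrite in_setT.
  have -> : S = range (fun j i => x i (J j i)).
    by apply/seteqP; split=> [t /p_surj|t [j _ <-]]; last exact: pS.
  have k_gt0 : (0 < k)%N.
    by have [j _ _] := p_surj s Ss; exact: leq_trans (ltn_ord j).
  rewrite good_row_free // /row_free; split=> [/eqP rM|[_ ->] //].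
  by split=> //; rewrite -{1}rM rank_incidence_mx.
- move=> m Y Y0 Ycard k _ k_le.
  have /choice[d dE] : forall i, exists d : nat, m i = d.+1.
    move=> i; case Em: (m i) => [|d]; last by exists d.
    have := Ycard i; rewrite Em II0 card_eq0 => /eqP Yi0.
    by have [y] := Y0 i; have := I : [set: Y i] y; rewrite Yi0.
  have {dE Ycard k_le m}[Ycard k_le] : (forall i, [set: Y i] #= `I_(d i).+1) /\
      (k <= (\sum_(i < n) d i).+1)%N.
    split=> [i|]; first by rewrite -dE.
    (* With [m i = d i + 1] the bound becomes [\sum_i d i + n - (n - 1)], which is [\sum_i d i + 1]
       since [n >= 1]. *)
    move: k_le; rewrite sum_predn => [|i]; last by rewrite dE.
    under eq_bigr do rewrite dE.
    by rewrite /= -addnBA ?leq_subr // subKn // addn1.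
  have [e e_inj] := fin_all_exists (fun i => card_ord_inj (Ycard i)).
  exact: (exists_good R n_ge1 e_inj).
Qed.
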